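(* Let $n\geq 2$ be an integer and let $F_X$ be a free group, freely generated by a set $X$ of cardinality $n$. For a positive integer $d$, let $m(n,d)$ be the maximum cardinality of a distinct difference configuration (DDC) of diameter $d$ in $F_X$. Then there exists a positive constant $c$ (independent of $d$, but depending on $n$) such that \[ m(n,d)\leq c\,(2n-1)^{d/3} \] for all sufficiently large $d$.
   Context: A subset $D$ of a group $G$ is a Distinct Difference Configuration (DDC) if the differences $g^{-1}h$ are distinct as $(g,h)$ ranges over all ordered pairs of distinct elements of $D$; that is, if $g\ne h$, $g'\neq h'$ are elements of $D$ with $g^{-1}h=(g')^{-1}h'$, then $(g,h)=(g',h')$. For a group $G$ with generating set $X$ and $g,h\in G$, $\mathrm{dist}(g,h)$ is the smallest non-negative integer $\ell$ such that $h=gy_1y_2\cdots y_\ell$ for some $y_1,\ldots,y_\ell\in X\cup X^{-1}$ (so $\mathrm{dist}(g,h)$ is the word length of $g^{-1}h$). The diameter of a subset $D\subseteq G$ is the minimum integer $d$ such that $\mathrm{dist}(g,h)\leq d$ for all $g,h\in D$ (if this integer exists). In $F_X$, distances and diameters are taken with respect to the free generating set $X$. *)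

(* Defs.v *)
From HB Require Import structures.
From mathcomp Require Import all_boot all_order all_algebra.
From mathcomp Require Import all_classical all_reals all_analysis.

Set Implicit Arguments.
Unset Strict Implicit.
Unset Printing Implicit Defensive.

Local Open Scope classical_set_scope.
Local Open Scope card_scope.
Local Open Scope group_scope.

(* [groupType] is the type of arbitrary, possibly infinite, groups. *)

Definition freely_generates (G : groupType) (X : set G) : Prop :=
  forall (H : groupType) (f : G -> H),
    exists2 phi : {multiplicative G -> H},
      forall x, X x -> phi x = f x &
      forall psi : {multiplicative G -> H},
        (forall x, X x -> psi x = f x) -> psi =1 phi.

Definition is_ddc (G : groupType) (D : set G) : Prop :=
  forall g h g' h', D g -> D h -> D g' -> D h' -> g <> h -> g' <> h' ->
    g^-1 * h = g'^-1 * h' -> (g, h) = (g', h').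

Definition is_least (P : set nat) (l : nat) : Prop :=
  P l /\ forall k, P k -> (l <= k)%N.

(* The lengths of the paths from [g] to [h] in the Cayley graph of [X]. *)
Definition path_lengths (G : groupType) (X : set G) (g h : G) : set nat :=
  [set l | exists ys : seq G, [/\ size ys = l,
    forall y, y \in ys -> X y \/ X y^-1 & h = g * \prod_(y <- ys) y]].

(* Relational, since no path exists when [X] does not generate [G]. *)
Definition is_dist (G : groupType) (X : set G) (g h : G) (l : nat) : Prop :=
  is_least (path_lengths X g h) l.

Definition has_diameter (G : groupType) (X D : set G) (d : nat) : Prop :=
  is_least [set e | forall g h, D g -> D h ->
                      exists2 l, is_dist X g h l & (l <= e)%N] d.

(* The upper bound ranges over all sets [D], so infinite ones are excluded. *)
Definition is_max_ddc_card (G : groupType) (X : set G) (d m : nat) : Prop :=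
  (exists D : set G, [/\ is_ddc D, has_diameter X D d & D #= `I_m]) /\
  (forall D : set G, is_ddc D -> has_diameter X D d -> D #<= `I_m).

(* Main.v *)
From HB Require Import structures.
Require Import Defs.
From mathcomp Require Import all_boot all_order all_algebra.
From mathcomp Require Import all_classical all_reals all_analysis.
From mathcomp Require Import finmap zify lra.
Import Order.TTheory GRing.Theory Num.Theory.
Local Open Scope classical_set_scope.
Local Open Scope card_scope.

(** Put k = 2n - 1.  The Cayley graph of a free group of rank n is a tree whose
    balls of radius r have O(k ^ r) elements, and a set D of diameter d in a
    tree lies in a ball of radius about d/2 around the middle of a longest
    geodesic between two of its points ([exists_center]).

    Translate this centre to 1 and write the elements of D as reduced words of
    length at most d/2.  Removing the last d/6 letters sends each of them into
    the ball of radius d/2 - d/6 = d/3, which has O(k ^ (d/3)) elements.  Two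
    elements g, h with the same truncation differ by at most d/6 letters on each
    side, so g^-1 h lies in the ball of radius d/3 around 1, which again has
    O(k ^ (d/3)) elements.  Keep one element of D for each truncation that
    occurs.  Each of the remaining elements h is paired with the retained g of
    the same truncation, and because the differences in D are distinct, h is
    determined by g^-1 h.  Hence D has O(k ^ (d/3)) + O(k ^ (d/3)) elements
    ([size_le_keys_plus_differences], [ddc_card_le]).  As the bound is uniform in
    D, and two points at distance d form a configuration, the maximum exists.

    Freeness is given by its universal property, so the tree has to be
    extracted from it.  Letting the group act on reduced words yields a normal
    form of each element ([exists_normal_form]), whose length is the distance to
    1 ([is_dist_nf]); the length of a common prefix then gives all distances
    ([size_nf_div]). *)

Set Implicit Arguments.
Unset Strict Implicit.
Unset Printing Implicit Defensive.

Local Open Scope group_scope.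

(** * The group of symmetries of a type *)

(** The freeness hypothesis only produces morphisms into groups, so each fact
    about the free group comes from letting it act on a suitable type.  Keeping
    the inverse in the record makes these actions computable. *)
Record symmetry (T : Type) := Symmetry {
  sym_fun :> T -> T;
  sym_inv : T -> T;
  sym_funK : cancel sym_fun sym_inv;
  sym_invK : cancel sym_inv sym_fun }.

Section SymmetryGroup.
Context {T : Type}.
Implicit Types s t : symmetry T.

(** A function has at most one two-sided inverse, and proofs are irrelevant. *)
Lemma symmetry_ext s t : s =1 t -> s = t.
Proof.
case: s t => [f f' fK f'K] [g g' gK g'K] /= /funext fg; subst g.
have f'g' : f' = g' by apply/funext => x; rewrite -{1}(g'K x) fK.
by subst g'; congr Symmetry; exact: Prop_irrelevance.
Qed.

Definition sym_one : symmetry T := @Symmetry T id id (frefl _) (frefl _).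
Definition sym_mul s t : symmetry T :=
  Symmetry (can_comp (sym_funK s) (sym_funK t))
           (can_comp (sym_invK t) (sym_invK s)).
Definition sym_opp s : symmetry T := Symmetry (sym_invK s) (sym_funK s).

HB.instance Definition _ := gen_eqMixin (symmetry T).
HB.instance Definition _ := gen_choiceMixin (symmetry T).

Lemma sym_mulA : associative sym_mul.
Proof. by move=> r s t; apply: symmetry_ext. Qed.
Lemma sym_mul1 : left_id sym_one sym_mul.
Proof. by move=> s; apply: symmetry_ext. Qed.
Lemma sym_mulr1 : right_id sym_one sym_mul.
Proof. by move=> s; apply: symmetry_ext. Qed.
Lemma sym_mulV : left_inverse sym_one sym_opp sym_mul.
Proof. by move=> s; apply: symmetry_ext => x /=; rewrite sym_funK. Qed.
Lemma sym_mulrV : right_inverse sym_one sym_opp sym_mul.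
Proof. by move=> s; apply: symmetry_ext => x /=; rewrite sym_invK. Qed.

HB.instance Definition _ :=
  isGroup.Build (symmetry T) sym_mulA sym_mul1 sym_mulr1 sym_mulV sym_mulrV.

End SymmetryGroup.

(** * Reduced words *)

Section Words.
Context {I : eqType}.
Local Notation letter := (I * bool)%type.
Implicit Types (a b : letter) (u v w : seq letter).

(** The letter [(i, b)] stands for generator [i], inverted when [b] is true. *)
Definition letter_inv a : letter := (a.1, ~~ a.2).
Definition word_inv w := rev (map letter_inv w).

Definition reduced w := sorted (fun a b => b != letter_inv a) w.

(** Left multiplication by a letter, on normal forms. *)
Definition push a w :=
  if w is b :: w' then if b == letter_inv a then w' else a :: w else [:: a].

Fixpoint common_prefix u v : nat :=
  match u, v with
  | a :: u', b :: v' => if a == b then (common_prefix u' v').+1 else 0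
  | _, _ => 0
  end.

Lemma letter_invK : involutive letter_inv.
Proof. by case=> i b; rewrite /letter_inv negbK. Qed.

Lemma reduced_cons a w :
  reduced (a :: w) = (if w is b :: _ then b != letter_inv a else true) && reduced w.
Proof. by case: w. Qed.

Lemma reduced_push a w : reduced w -> reduced (push a w).
Proof.
case: w => [|b w] // rw; rewrite /push; case: eqP => [_|/eqP ba].
  by move: rw; rewrite reduced_cons => /andP[].
by rewrite reduced_cons ba.
Qed.

Lemma push_letter_invK a w : reduced w -> push (letter_inv a) (push a w) = w.
Proof.
case: w => [|b w]; first by rewrite /= letter_invK eqxx.
rewrite reduced_cons /=; case: eqP => [->|_ _]; last by rewrite /= letter_invK eqxx.
by case: w => [|c w] //= /andP[/negPf->].
Qed.

Lemma push_reduced a w : reduced (a :: w) -> push a w = a :: w.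
Proof. by rewrite reduced_cons; case: w => [|b w] // /andP[/negPf /= ->]. Qed.

Lemma size_push a w : (size (push a w) <= (size w).+1)%N.
Proof. by case: w => [|b w] //=; case: ifP => //= _; lia. Qed.

Lemma reduced_take k w : reduced w -> reduced (take k w).
Proof. exact: take_sorted. Qed.

Lemma size_word_inv w : size (word_inv w) = size w.
Proof. by rewrite size_rev size_map. Qed.

(** Two reduced words that start differently are the two arms of a geodesic
    through the root, so no cancellation occurs.  In the induction, the first
    letter of [u] is moved to the front of [v] as its inverse. *)
Lemma reduced_word_inv_cat u v : reduced u -> reduced v ->
  common_prefix u v = 0%N -> reduced (word_inv u ++ v).
Proof.
elim: u v => [|a u IHu] v //.
rewrite reduced_cons => /andP[au ru] rv auv.
have -> : word_inv (a :: u) ++ v = word_inv u ++ letter_inv a :: v.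
  by rewrite /word_inv /= rev_cons cat_rcons.
apply: IHu => //.
- rewrite reduced_cons rv andbT letter_invK.
  by case: v auv {rv} => [|b v] //=; rewrite eq_sym; case: eqP.
- by case: u au {ru auv} => [|b u] //= /negPf->.
Qed.

Lemma common_prefix_take k u v :
  common_prefix (take k u) v = minn k (common_prefix u v).
Proof.
elim: u v k => [|a u IHu] [|b v] [|k] //=; rewrite ?minn0 ?min0n //.
by case: eqP => // _; rewrite IHu minnSS.
Qed.

End Words.

Section Ball.
Context {I : finType}.
Local Notation letter := (I * bool)%type.
Implicit Types (a b : letter) (w : seq letter).

(** Each new letter has [2 * #|I| - 1] choices, all letters but the inverse of
    its predecessor; this number is the growth rate of the group. *)
Fixpoint words_after a (r : nat) : seq (seq letter) :=
  [::] :: (if r is r'.+1 then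
    [seq b :: w | b <- rem (letter_inv a) (enum {: letter}), w <- words_after b r']
    else [::]).

Lemma mem_words_after a r w :
  reduced (a :: w) -> (size w <= r)%N -> w \in words_after a r.
Proof.
elim: r a w => [|r IHr] a [|b w] //; rewrite ?in_cons //.
rewrite reduced_cons => /andP[ba rw] wr /=.
apply: allpairs_f_dep; last exact: IHr.
by rewrite mem_rem_uniq ?enum_uniq // inE ba mem_enum.
Qed.

Lemma size_words_after a r :
  size (words_after a r) = iter r (fun m => ((#|I|.*2 - 1) * m).+1) 1%N.
Proof.
elim: r a => //= r IHr a; rewrite size_allpairs_dep.
rewrite sumnE big_map (eq_bigr _ (fun b _ => IHr b)) big_const_seq iter_addn_0.
rewrite count_predT mulnC size_rem ?mem_enum // -cardT.
by rewrite card_prod card_bool muln2 subn1.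
Qed.

(** A reduced word may follow every letter except the inverse of its first one,
    hence it may follow one of any two distinct letters. *)
Lemma ball_words r : (1 < #|I|)%N ->
  exists2 B : seq (seq letter), (size B <= (#|I|.*2 - 1) ^ r.+1)%N &
    forall w, reduced w -> (size w <= r)%N -> w \in B.
Proof.
move=> I2; have i : I by case: (pickP I) => [//|I0]; rewrite eq_card0 in I2.
exists (words_after (i, false) r ++ words_after (i, true) r).
  rewrite size_cat !size_words_after addnn.
  set k := (_ - 1)%N; have k3 : (3 <= k)%N by rewrite /k; lia.
  (* The successor on the left makes the induction go through, as 3 <= k. *)
  suff : ((iter r (fun m => (k * m).+1) 1%N).*2.+1 <= k ^ r.+1)%N by apply: ltnW.
  elim: r => [|r IHr]; first by rewrite expn1.
  rewrite expnS; apply: leq_trans (leq_mul (leqnn k) IHr).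
  rewrite iterS; nia.
move=> w rw wr; rewrite mem_cat.
have [r1|r1] := boolP (reduced ((i, false) :: w)); first by rewrite mem_words_after.
rewrite orbC mem_words_after //; move: r1; rewrite !reduced_cons rw !andbT.
by case: w {rw wr} => // b w /negPn /eqP ->; rewrite xpair_eqE andbF.
Qed.

End Ball.

(** * A pigeonhole principle for distinct differences *)

(** Choose one representative of each key.  The representatives are counted by
    their keys in [B]; every other element [x] is recovered from the difference
    [delta (rep x) x] in [C], because all differences are distinct.  Comparing
    with one representative only, instead of counting all pairs with equal keys,
    makes the estimate linear. *)
Lemma size_le_keys_plus_differences (T K V : eqType) (key : T -> K)
    (delta : T -> T -> V) (A : seq T) (B : seq K) (C : seq V) :
  uniq A ->
  {in A, forall x, key x \in B} ->
  {in A &, forall x y, key x = key y -> delta x y \in C} ->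
  (forall x y x' y', x \in A -> y \in A -> x' \in A -> y' \in A ->
    x <> y -> x' <> y' -> delta x y = delta x' y' -> (x, y) = (x', y')) ->
  (size A <= size B + size C)%N.
Proof.
case: A => [//|x0 A0]; set A := x0 :: A0 => uA AB AC inj.
pose rep x := nth x0 A (index (key x) (map key A)).
have ltrep x : x \in A -> (index (key x) (map key A) < size A)%N.
  by move=> xA; rewrite -(size_map key) index_mem map_f.
have repA x : x \in A -> rep x \in A by move=> xA; rewrite mem_nth ?ltrep.
have keyrep x : x \in A -> key (rep x) = key x.
  by move=> xA; rewrite /rep -(nth_map _ (key x0)) ?ltrep // nth_index ?map_f.
pose isrep x := rep x == x.
rewrite -(count_predC isrep) -!size_filter leq_add //.
  rewrite -(size_map key); apply: uniq_leq_size.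
    rewrite map_inj_in_uniq ?filter_uniq // => x y.
    rewrite !mem_filter => /andP[/eqP xr xA] /andP[/eqP yr yA] kxy.
    by rewrite -xr -yr /rep kxy.
  by move=> _ /mapP[x + ->]; rewrite mem_filter => /andP[_ /AB].
rewrite -(size_map (fun x => delta (rep x) x)); apply: uniq_leq_size.
  rewrite map_inj_in_uniq ?filter_uniq // => x y.
  rewrite !mem_filter => /andP[/eqP xr xA] /andP[/eqP yr yA] dxy.
  by case: (inj _ _ _ _ (repA _ xA) xA (repA _ yA) yA xr yr dxy).
move=> _ /mapP[x + ->]; rewrite mem_filter => /andP[_ xA].
by apply: AC; rewrite ?repA ?keyrep.
Qed.

(** * Normal forms in a free group *)

Section Generation.
Context {F : groupType} (P : set F).

Definition translation (g : F) : symmetry (F * bool) :=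
  @Symmetry (F * bool) (fun p => (g * p.1, p.2)) (fun p => (g^-1 * p.1, p.2))
    (fun p => ltac:(by case: p => h b /=; rewrite mulKg))
    (fun p => ltac:(by case: p => h b /=; rewrite mulVKg)).

Definition flip_on (p : F * bool) : F * bool := (p.1, `[< P p.1 >] (+) p.2).

Lemma flip_onK : involutive flip_on.
Proof. by case=> h b; rewrite /flip_on /= addKb. Qed.

Definition flip : symmetry (F * bool) := Symmetry flip_onK flip_onK.

Definition flipped_translation g := flip * translation g * flip.

Lemma translationM : {morph translation : g h / g * h}.
Proof.
by move=> g h; apply: symmetry_ext => -[k b] /=; rewrite mulgA.
Qed.

Lemma flipped_translationM : {morph flipped_translation : g h / g * h}.
Proof.
have flip2 : flip * flip = 1 by apply: symmetry_ext => p /=; rewrite flip_onK.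
move=> g h; rewrite /flipped_translation translationM !mulgA.
by rewrite -[_ * flip * flip]mulgA flip2 mulg1.
Qed.

HB.instance Definition _ :=
  isMultiplicative.Build F (symmetry (F * bool)) translation translationM.
HB.instance Definition _ :=
  isMultiplicative.Build F (symmetry (F * bool)) flipped_translation
    flipped_translationM.

(** Induction along the generators.  Take two copies of the group, on which it
    acts by translation, and let [flip] exchange the copies above [P].  A
    translation by a generator preserves [P], hence commutes with [flip], so the
    translation action and its conjugate by [flip] agree on [X] and, by
    uniqueness, everywhere.  Following the point [1], at which [flip] acts,
    shows that [flip] also acts at each [g]. *)
Lemma freely_generates_ind (X : set F) : freely_generates X ->
  P 1 -> (forall x h, X x -> P (x * h) <-> P h) -> forall g, P g.
Proof.
move=> /(_ _ translation) [phi _ phi_uniq] P1 PX g.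
have eqT : translation =1 flipped_translation.
  move=> {}g; rewrite (phi_uniq translation) // (phi_uniq flipped_translation) //.
  move=> x Xx; apply: symmetry_ext => -[h b]; rewrite /= /flip_on /=.
  by rewrite (asbool_equiv_eq (PX x h Xx)) addKb.
have /(congr1 (fun s : symmetry _ => (s (1, false)).2)) := eqT g.
by rewrite /= /flip_on /= mulg1 (asboolT P1) addbT => /esym /negbFE /asboolP.
Qed.

End Generation.

Section NormalForms.
Context {F : groupType} {I : eqType} (e : I -> F).
Local Notation letter := (I * bool)%type.
Local Notation rword := {w : seq letter | reduced w}.
Implicit Types (a b : letter) (u v w : seq letter) (g h : F).

Definition letter_val a : F := if a.2 then (e a.1)^-1 else e a.1.
Definition word_val w : F := \prod_(a <- w) letter_val a.

Record normal_form (nf : F -> seq letter) : Prop := NormalForm {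
  nf_reduced : forall g, reduced (nf g);
  nf1 : nf 1 = [::];
  nf_letter : forall a g, nf (letter_val a * g) = push a (nf g);
  nfK : forall g, word_val (nf g) = g }.

Lemma letter_val_inv a : letter_val (letter_inv a) = (letter_val a)^-1.
Proof. by case: a => i []; rewrite /letter_val /= ?invgK. Qed.

Lemma word_val_nil : word_val [::] = 1.
Proof. exact: big_nil. Qed.

Lemma word_val_cons a w : word_val (a :: w) = letter_val a * word_val w.
Proof. exact: big_cons. Qed.

Lemma word_val_cat u v : word_val (u ++ v) = word_val u * word_val v.
Proof. exact: big_cat. Qed.

Lemma word_val_inv w : word_val (word_inv w) = (word_val w)^-1.
Proof.
elim: w => [|a w IHw]; first by rewrite /word_inv /= /rev /= word_val_nil invg1.
rewrite /word_inv /= rev_cons -cats1 word_val_cat IHw !word_val_cons.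
by rewrite letter_val_inv word_val_nil mulg1 invgM.
Qed.

Lemma word_val_push a w : word_val (push a w) = letter_val a * word_val w.
Proof.
case: w => [|b w]; first by rewrite word_val_cons.
rewrite /push; case: eqP => [->|_]; rewrite !word_val_cons //.
by rewrite letter_val_inv mulVKg.
Qed.

Definition push_rword a (w : rword) : rword :=
  exist _ (push a (val w)) (reduced_push a (valP w)).

Lemma push_rwordK a : cancel (push_rword a) (push_rword (letter_inv a)).
Proof. by move=> w; apply: val_inj; rewrite /= push_letter_invK // (valP w). Qed.

Lemma push_rwordVK a : cancel (push_rword (letter_inv a)) (push_rword a).
Proof. by rewrite -{2}(letter_invK a); exact: push_rwordK. Qed.

Definition push_symmetry a : symmetry rword :=
  Symmetry (push_rwordK a) (push_rwordVK a).

(** The universal property for functions of the indices; injectivity of [e] is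
    what makes a function on indices a function on generators. *)
Lemma free_lift (H : groupType) (f : I -> H) :
  injective e -> freely_generates (range e) ->
  exists phi : {multiplicative F -> H}, forall i, phi (e i) = f i.
Proof.
move=> e_inj freeF.
pose f' x := if pselect (exists i, e i = x) is left ex then f (sval (cid ex)) else 1.
have [phi phiE _] := freeF H f'; exists phi => i.
rewrite phiE; last by exists i.
rewrite /f'; case: pselect => [ex|[]]; last by exists i.
by congr f; apply: e_inj; case: cid.
Qed.

(** The generators act on reduced words by [push], hence so does the whole group,
    and the normal form of [g] is the image of the empty word under [g].  That
    [g] is the value of its normal form holds at [1] and is preserved by
    generators in both directions, which is the form of induction available. *)
Lemma exists_normal_form :
  injective e -> freely_generates (range e) -> exists nf, normal_form nf.
Proof.
move=> e_inj freeF.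
have [phi phiE] := free_lift (fun i => push_symmetry (i, false)) e_inj freeF.
have phi1 : phi 1 = 1 by apply: (mulgI (phi 1)); rewrite -gmulfM !mulg1.
have phi_letter a (w : rword) : phi (letter_val a) w = push_rword a w.
  case: a => i []; rewrite /letter_val /= ?phiE //.
  suff -> : phi (e i)^-1 = (push_symmetry (i, false))^-1 by [].
  by apply: (mulgI (phi (e i))); rewrite -gmulfM phiE !mulgV.
pose nf g := val (phi g (exist _ [::] isT)).
have nf_letter a g : nf (letter_val a * g) = push a (nf g).
  by rewrite /nf gmulfM -[LHS]/(val (phi (letter_val a) _)) phi_letter.
exists nf; split=> //.
- by move=> g; apply: valP.
- by rewrite /nf phi1.
- apply: (freely_generates_ind (P := fun g => word_val (nf g) = g) freeF).
    by rewrite /nf phi1 word_val_nil.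
  move=> _ h [i _ <-]; rewrite -[e i]/(letter_val (i, false)) nf_letter word_val_push.
  by split=> [/mulgI|->].
Qed.

Section Length.
Context (nf : F -> seq letter) (nfP : normal_form nf).

Lemma nf_inj : injective nf.
Proof. exact: can_inj (nfK nfP). Qed.

Lemma nf_word w : reduced w -> nf (word_val w) = w.
Proof.
elim: w => [|a w IHw]; first by rewrite word_val_nil (nf1 nfP).
move=> raw; have := raw; rewrite {1}reduced_cons => /andP[_ rw].
by rewrite word_val_cons (nf_letter nfP) IHw // push_reduced.
Qed.

Lemma size_nf_word w : (size (nf (word_val w)) <= size w)%N.
Proof.
elim: w => [|a w IHw]; first by rewrite word_val_nil (nf1 nfP).
rewrite word_val_cons (nf_letter nfP).
exact: leq_trans (size_push _ _) _.
Qed.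

(** The distance formula in a tree: the geodesic from [g] to [h] leaves the path
    from [g] to the root where the two normal forms separate. *)
Lemma size_nf_div g h :
  (size (nf (g^-1 * h)) + (common_prefix (nf g) (nf h)).*2
   = size (nf g) + size (nf h))%N.
Proof.
rewrite -{1}(nfK nfP g) -{1}(nfK nfP h).
have := nf_reduced nfP h; have := nf_reduced nfP g.
elim: (nf g) (nf h) => [|a u IHu] v ru rv.
  by rewrite addn0 word_val_nil invg1 mul1g nf_word.
have [auv|] := eqVneq (common_prefix (a :: u) v) 0%N.
  rewrite auv -word_val_inv -word_val_cat nf_word ?reduced_word_inv_cat //.
  by rewrite size_cat size_word_inv addn0.
case: v rv => [|b v] //= rv; have [<- _|//] := eqVneq a b.
rewrite !word_val_cons invgM mulgA mulgVK doubleS !addnS IHu ?addSn //.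
  exact: path_sorted ru.
exact: path_sorted rv.
Qed.

Lemma is_dist_nf g h l :
  is_dist (range e) g h l <-> l = size (nf (g^-1 * h)).
Proof.
have lb k : path_lengths (range e) g h k -> (size (nf (g^-1 * h)) <= k)%N.
  case=> ys [<- ysX ->]; rewrite mulKg.
  suff [w <- ->] : exists2 w, size w = size ys & \prod_(y <- ys) y = word_val w.
    exact: size_nf_word.
  elim: ys ysX => [|y ys IHys] ysX.
    by exists [::] => //; rewrite big_nil word_val_nil.
  have [|w sw pw] := IHys; first by move=> z zys; apply: ysX; rewrite inE zys orbT.
  have [a ya] : exists a, y = letter_val a.
    have [[i _ yi]|[i _ yi]] := ysX y (mem_head _ _).
      by exists (i, false).
    by exists (i, true); rewrite /letter_val /= yi invgK.
  by exists (a :: w); rewrite /= ?sw // big_cons word_val_cons ya pw.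
have path : path_lengths (range e) g h (size (nf (g^-1 * h))).
  exists (map letter_val (nf (g^-1 * h))); split.
  - exact: size_map.
  - move=> _ /mapP[[i []] _ ->]; [right|left]; exists i => //.
    by rewrite /letter_val /= invgK.
  - by rewrite big_map -/(word_val _) (nfK nfP) mulVKg.
split=> [[/lb l1 /(_ _ path) l2]|->]; last by split.
by apply/eqP; rewrite eqn_leq l1 l2.
Qed.

End Length.
End NormalForms.

(** * Distinct difference configurations *)

(** The exponents are, up to the successor that comes from [ball_words], the
    radius of a ball containing the prefixes left after the last [d %/ 6] letters
    of words of length at most [uphalf d] are removed, and that of a ball
    containing the differences of two words with the same such prefix.  Both are
    [d / 3] up to a constant. *)
Definition ddc_bound (k d : nat) : nat :=
  (k ^ (uphalf d - d %/ 6).+1 + k ^ (d %/ 6).*2.+1)%N.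

Section Configurations.
Context {F : groupType} {I : finType} (e : I -> F).
Context (nf : F -> seq (I * bool)) (nfP : normal_form e nf).
Implicit Types (D : set F) (g h : F) (d k : nat).

Local Notation len g := (size (nf g)).

Definition diameter_le D d := forall g h, D g -> D h -> (len (g^-1 * h) <= d)%N.

Lemma has_diameter_le D d : has_diameter (range e) D d -> diameter_le D d.
Proof. by case=> Dd _ g h Dg /(Dd g h Dg)[l /(is_dist_nf nfP) ->]. Qed.

(** The centre is the middle of a longest geodesic, from [a] to [b].  The paths
    from [a] to [b] and to [h] part after [q] steps; as [h] is no farther from
    [b] than [a] is, [q] is at least half the distance from [a] to [h], and the
    distance from the middle to [h] follows in each of the cases where the
    parting point lies before or after the middle. *)
Lemma exists_center D d : diameter_le D d ->
  exists c, forall h, D h -> (len (c^-1 * h) <= uphalf d)%N.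
Proof.
move=> Dd; have [[x Dx]|D0] := pselect (exists x, D x); last first.
  by exists 1 => h Dh; case: D0; exists h.
pose P l := `[< exists a b, [/\ D a, D b & l = len (a^-1 * b)] >].
have exP : exists l, P l by exists (len (x^-1 * x)); apply/asboolP; exists x, x.
have leP l : P l -> (l <= d)%N by move=> /asboolP[a [b [Da Db ->]]]; exact: Dd.
case: (ex_maxnP exP leP) => m /[dup] /leP md /asboolP[a [b [Da Db mE]]] maxm.
exists (a * word_val e (take m./2 (nf (a^-1 * b)))) => h Dh.
have ah : (len (a^-1 * h) <= m)%N by apply: maxm; apply/asboolP; exists a, h.
have bh : (len (b^-1 * h) <= m)%N by apply: maxm; apply/asboolP; exists b, h.
have := size_nf_div nfP (word_val e (take m./2 (nf (a^-1 * b)))) (a^-1 * h).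
have := size_nf_div nfP (a^-1 * b) (a^-1 * h).
rewrite (nf_word nfP) ?reduced_take ?(nf_reduced nfP) // common_prefix_take.
rewrite !invgM invgK !mulgA mulgK uphalfE size_takel -?mE; last lia.
move: md (len (a^-1 * h)) (len (b^-1 * h)) ah bh (len _) (common_prefix _ _).
move=> {Dd leP exP maxm} md; lia.
Qed.

Lemma finite_diameter_le D d : (1 < #|I|)%N -> diameter_le D d -> finite_set D.
Proof.
move=> I2 /exists_center[c Dc].
have [B _ ballB] := ball_words (uphalf d) I2.
apply: (sub_finite_set (B := (fun w => c * word_val e w) @` [set` B])).
  move=> h Dh; exists (nf (c^-1 * h)); last by rewrite (nfK nfP) mulVKg.
  by apply: ballB; rewrite ?(nf_reduced nfP) ?Dc.
exact/finite_image/finite_seq.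
Qed.

(** Seen from the centre, the elements are words of length at most [uphalf d].
    The key of an element is that word without its last [d %/ 6] letters, so
    elements with the same key are at distance at most twice [d %/ 6]. *)
Lemma ddc_card_le D d m : (1 < #|I|)%N -> is_ddc D -> diameter_le D d ->
  D #= `I_m ->
  (m <= ddc_bound (#|I|.*2 - 1) d)%N.
Proof.
move=> I2 ddcD Dd Dm; have finD := finite_diameter_le I2 Dd.
have [c Dc] := exists_center Dd.
have [B sizeB ballB] := ball_words (uphalf d - d %/ 6) I2.
have [C sizeC ballC] := ball_words (d %/ 6).*2 I2.
have memD g : (g \in enum_fset (fset_set D)) -> D g.
  by move=> gD; have := in_fset_set finD g; rewrite gD => /esym /set_mem.
rewrite -(card_fset_set Dm); apply: leq_trans (leq_add sizeB sizeC).
pose cut (w : seq (I * bool)) := (size w - d %/ 6)%N.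
pose key g := take (cut (nf (c^-1 * g))) (nf (c^-1 * g)).
apply: (size_le_keys_plus_differences (key := key)
  (delta := fun g h => nf (g^-1 * h))).
- exact: fset_uniq.
- move=> g /memD Dg; apply: ballB; first exact/reduced_take/(nf_reduced nfP).
  by rewrite size_take_min /cut; have := Dc g Dg; rewrite uphalfE; lia.
- move=> g h _ _ gh; apply: ballC; first exact: nf_reduced nfP _.
  pose tail g := drop (cut (nf (c^-1 * g))) (nf (c^-1 * g)).
  have split_word x : x = c * word_val e (key x) * word_val e (tail x).
    by rewrite -mulgA -word_val_cat cat_take_drop (nfK nfP) mulVKg.
  have -> : g^-1 * h = word_val e (word_inv (tail g) ++ tail h).
    rewrite word_val_cat word_val_inv {1}(split_word g) {1}(split_word h) gh.
    by rewrite !invgM -!mulgA !mulKg.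
  apply: leq_trans (size_nf_word nfP _) _.
  by rewrite size_cat size_word_inv !size_drop /cut -addnn leq_add // leq_subLR addnC -leq_subLR.
- move=> g h g' h' /memD Dg /memD Dh /memD Dg' /memD Dh' gh gh' /(nf_inj nfP).
  exact: ddcD.
Qed.

(** Two points at distance [d] form a configuration because their difference is
    not an involution; powers of a generator provide them. *)
Lemma ddc_of_diameter (i : I) d : (0 < d)%N -> exists D,
  [/\ is_ddc D, has_diameter (range e) D d & finite_set D].
Proof.
move=> d0; pose power m := word_val e (nseq m (i, false)).
have len_power m : len (power m) = m.
  rewrite (nf_word nfP) ?size_nseq //; elim: m => // m IHm.
  by rewrite (reduced_cons _ (nseq m _)) IHm; case: m {IHm} => //= m; rewrite xpair_eqE andbF.
have powerD k m : power (k + m)%N = power k * power m by rewrite /power nseqD word_val_cat.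
have len1 : len 1 = 0%N by rewrite (nf1 nfP).
pose y := power d; have y2 : y * y <> 1.
  by move=> y2; move: (len_power (d + d)%N); rewrite powerD -/y y2 len1; lia.
have lenV : len (y^-1) = d.
  have := size_nf_div nfP y 1; rewrite mulg1 (nf1 nfP) /= addn0 len_power => <-.
  by case: (nf y) => [|a u]; rewrite addn0.
exists [set 1; y]; split; last exact: finite_set2.
- have yV : y <> y^-1 by move=> yV; apply: y2; rewrite {1}yV mulVg.
  move=> g h g' h' [] -> [] -> [] -> [] -> //; rewrite ?invg1 ?mul1g ?mulg1 //.
  by move=> _ _ /esym.
- split.
    move=> g h Dg Dh; exists (len (g^-1 * h)); first exact/(is_dist_nf nfP).
    case: Dg Dh => -> [] ->; rewrite ?invg1 ?mul1g ?mulg1 ?mulVg ?len1 //.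
      by rewrite len_power.
    by rewrite lenV.
  move=> k /(_ 1 y (or_introl erefl) (or_intror erefl))[l /(is_dist_nf nfP) ->].
  by rewrite invg1 mul1g len_power.
Qed.

(** The cardinalities of configurations of diameter [d] are bounded, and there is
    at least one, so a largest one exists. *)
Lemma exists_max_ddc_card d : (1 < #|I|)%N -> (0 < d)%N ->
  exists m, is_max_ddc_card (range e) d m /\
  (m <= ddc_bound (#|I|.*2 - 1) d)%N.
Proof.
move=> I2 d0.
have i : I by case: (pickP I) => [//|I0]; rewrite eq_card0 in I2.
pose P m := `[< exists D, [/\ is_ddc D, has_diameter (range e) D d & D #= `I_m] >].
have exP : exists m, P m.
  have [D [ddcD Dd /finite_setP[m Dm]]] := ddc_of_diameter i d0.
  by exists m; apply/asboolP; exists D.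
have leP m : P m -> (m <= ddc_bound (#|I|.*2 - 1) d)%N.
  by move=> /asboolP[D [ddcD /has_diameter_le Dd Dm]]; exact: ddc_card_le Dm.
case: (ex_maxnP exP leP) => m Pm maxm; exists m; split; last exact: leP.
split; first exact/asboolP.
move=> D ddcD Dd.
have /finite_setP[k Dk] := finite_diameter_le I2 (has_diameter_le Dd).
rewrite (card_le_eql Dk) card_le_II; apply: maxm.
by apply/asboolP; exists D.
Qed.

End Configurations.

(** * The bound *)

Lemma enumerate_set (T : choiceType) (X : set T) n : X #= `I_n ->
  exists2 e : 'I_n -> T, injective e & range e = X.
Proof.
move=> Xn; have finX : finite_set X by apply/finite_setP; exists n.
pose t : n.-tuple T := Tuple (introT eqP (card_fset_set Xn)).
exists (tnth t); first exact/tuple_uniqP/fset_uniq.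
apply/seteqP; split=> [_ [i _ <-]|x Xx].
  by apply/set_mem; rewrite -(in_fset_set finX); exact: mem_tnth.
have /tnthP[i ->] : x \in t by have := in_fset_set finX x; rewrite mem_set.
by exists i.
Qed.

Local Close Scope group_scope.
Local Open Scope ring_scope.

(** The slack of three in the exponent absorbs the roundings in [uphalf d] and
    [d %/ 6] and the successors in [ddc_bound]. *)
Lemma expr_le_powR_third (R : realType) (a : R) (j d : nat) : 1 <= a ->
  (3 * j <= d + 9)%N -> a ^+ j <= a ^+ 3 * a `^ (d%:R / 3).
Proof.
move=> a1 jd; have a0 : 0 < a by exact: lt_le_trans a1.
rewrite -!powR_mulrn ?(ltW a0) // -powRD; last by rewrite gt_eqF ?implybT.
apply: ler_powR => //.
have : (3 * j)%:R <= (d + 9)%:R :> R by rewrite ler_nat.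
by rewrite natrM natrD; lra.
Qed.

Theorem theorem3 (R : realType) (n : nat) (hn : (2 <= n)%N) :
  exists c : R, 0 < c /\
    forall (F : groupType) (X : set F),
      X #= `I_n -> freely_generates X ->
      \forall d \near \oo,
        exists m : nat, is_max_ddc_card X d m /\
          m%:R <= c * (2 * n%:R - 1) `^ (d%:R / 3).
Proof.
have kE : (n.*2 - 1)%:R = 2 * n%:R - 1 :> R.
  by rewrite natrB -?muln2 ?natrM 1?mulrC //; lia.
have k1 : 1 <= 2 * n%:R - 1 :> R by rewrite -kE ler1n; lia.
exists (2 * (2 * n%:R - 1) ^+ 3); split.
  by rewrite mulr_gt0 // exprn_gt0 //; lra.
move=> F X /enumerate_set[e e_inj <-] freeF.
have [nf nfP] := exists_normal_form e_inj freeF.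
exists 1%N => // d /= d1.
have [|m [maxm lem]] := @exists_max_ddc_card F 'I_n e nf nfP d _ d1.
  by rewrite card_ord.
exists m; split=> //; rewrite card_ord in lem.
apply: le_trans (_ : (ddc_bound (n.*2 - 1) d)%:R <= _); first by rewrite ler_nat.
rewrite natrD !natrX kE -mulrA [leRHS]mulr_natl [leRHS]mulr2n.
by apply: lerD; apply: expr_le_powR_third => //; lia.
Qed.
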